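(* Let $(M; F)$ be a multi-algebra. Then there exist an algebra $(A; F)$ (of the same type, i.e. with one $n$-ary operation on $A$ for each $n$-ary $f \in F$) and a full covering $\mathcal{C}$ of $(A; F)$ that induces a tolerance $\tau$ on $(A; F)$ (that is, $\tau$ is a tolerance on $(A;F)$, $\mathcal{C}$ is a covering of $A$ consisting of tolerance blocks of $\tau$, and for all $a, b \in A$, $(a,b) \in \tau$ if and only if $a, b \in C$ for some $C \in \mathcal{C}$) such that $(M; F)$ is isomorphic to the full covering quotient $(A; F)/\mathcal{C}$.
   Context: For a set $M$, let $\mathcal{P}_+(M)$ denote the set of all nonempty subsets of $M$. A multi-operation of arity $n$ on a nonempty set $M$ is a function $f \colon M^n \to \mathcal{P}_+(M)$. A multi-algebra $(M; F)$ is a nonempty set $M$ with a set $F$ of multi-operations on $M$ (each of some finite arity). An algebra $(A; F)$ is a nonempty set $A$ with a set $F$ of ordinary (single-valued) finitary operations on $A$. The elements of $F$ are treated as operation symbols with given arities, so that the same $F$ is used for structures of the same type. A tolerance on an algebra $(A; F)$ is a reflexive and symmetric binary relation $\tau$ on $A$ with the Substitution Property: for every $n$-ary $f \in F$, if $(a_i, b_i) \in \tau$ for $1 \le i \le n$, then $(f(a_1,\dots,a_n), f(b_1,\dots,b_n)) \in \tau$. A subset $B \subseteq A$ is a clique of $\tau$ if $B^2 \subseteq \tau$, and a tolerance block of $\tau$ is a clique of $\tau$ that is maximal with respect to inclusion. A covering of a nonempty set $A$ is a collection of pairwise incomparable (with respect to inclusion) subsets of $A$ whose union is $A$. Given a tolerance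 $\tau$ on $(A; F)$, a full covering is a covering $\mathcal{C}$ of $A$ consisting of some (not necessarily all) tolerance blocks of $\tau$ such that for all $a, b \in A$: $(a, b) \in \tau$ if and only if there is some $C \in \mathcal{C}$ with $a, b \in C$. The full covering quotient $(A; F)/\mathcal{C}$ has underlying set $\mathcal{C}$, and for each $n$-ary $f \in F$ and $C_1, \dots, C_n \in \mathcal{C}$, $$f(C_1, \dots, C_n) = \{\, C \in \mathcal{C} : f(c_1, \dots, c_n) \in C \text{ for all } c_1 \in C_1, \dots, c_n \in C_n \,\} \subseteq \mathcal{C}.$$ An isomorphism from $(M; F)$ to $(A; F)/\mathcal{C}$ is a bijection $\varphi \colon M \to \mathcal{C}$ such that for every $n$-ary $f \in F$ and all $m_1, \dots, m_n \in M$, $\{\varphi(m) : m \in f(m_1, \dots, m_n)\} = f(\varphi(m_1), \dots, \varphi(m_n))$. *)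

(* Defs.v *)
From mathcomp Require Import all_boot.
From mathcomp Require Import boolp classical_sets functions.

Set Implicit Arguments.
Unset Strict Implicit.
Unset Printing Implicit Defensive.

Local Open Scope classical_set_scope.

(* A type of structures is a collection [F] of operation symbols with an arity
   map [ar : F -> nat]; arity 0 is allowed.  An n-tuple of elements of [T] is a
   function ['I_n -> T]. *)

Record multiAlgebra (F : Type) (ar : F -> nat) : Type := MultiAlgebra {
  mcarrier :> Type;
  mcarrier_inhabited : inhabited mcarrier;
  mop : forall f : F, ('I_(ar f) -> mcarrier) -> set mcarrier;
  mop_nonempty : forall (f : F) (m : 'I_(ar f) -> mcarrier), mop m !=set0
}.

Record algebra (F : Type) (ar : F -> nat) : Type := Algebra {
  acarrier :> Type;
  acarrier_inhabited : inhabited acarrier;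
  aop : forall f : F, ('I_(ar f) -> acarrier) -> acarrier
}.

Arguments mop {F ar} _ f _ : rename.
Arguments aop {F ar} _ f _ : rename.

Section Tolerances.
Variables (F : Type) (ar : F -> nat) (A : algebra ar).
Implicit Types (tau : A -> A -> Prop) (B C : set A) (CC : set (set A)).

Definition substitution_property tau : Prop :=
  forall (f : F) (a b : 'I_(ar f) -> A),
    (forall i, tau (a i) (b i)) -> tau (aop A f a) (aop A f b).

Definition tolerance tau : Prop :=
  [/\ forall a, tau a a,
      forall a b, tau a b -> tau b a
    & substitution_property tau].

Definition clique tau B : Prop := forall a b, B a -> B b -> tau a b.

Definition tolerance_block tau B : Prop :=
  clique tau B /\ forall C, clique tau C -> B `<=` C -> C = B.

Definition covering CC : Prop :=
  (forall B C, CC B -> CC C -> B `<=` C -> B = C) /\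
  \bigcup_(C in CC) C = [set: A].

Definition full_covering tau CC : Prop :=
  [/\ covering CC,
      CC `<=` tolerance_block tau
    & forall a b, tau a b <-> exists C, [/\ CC C, C a & C b]].

(* The operations of the quotient of [A] by [CC], whose underlying set is [CC];
   they are only used on tuples of members of [CC].  For an arbitrary full
   covering the value may be empty, so this is not packed as a
   [multiAlgebra]. *)
Definition quotient_op CC (f : F) (Cs : 'I_(ar f) -> set A) : set (set A) :=
  [set C | CC C /\
     forall c : 'I_(ar f) -> A, (forall i, Cs i (c i)) -> C (aop A f c)].

Definition isomorphism_to_quotient (M : multiAlgebra ar) CC
    (phi : M -> set A) : Prop :=
  set_bij [set: M] CC phi /\
  forall (f : F) (m : 'I_(ar f) -> M),
    phi @` mop M f m = quotient_op CC (fun i => phi (m i)).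

End Tolerances.

(* Main.v *)
(* Take for A the set of nonempty subsets of M, with
   f(S_1, ..., S_n) the union of all f(s_1, ..., s_n) with s_i in S_i, let tau
   be the relation "S and T meet", and let phi m be the set of all S containing
   m.  Any T meeting every member of phi m meets [set m], so phi m is a maximal
   clique.  The value f(S_1, ..., S_n) contains f(m_1, ..., m_n) whenever m_i
   lies in S_i for all i, and equals it when the S_i are the singletons of the
   m_i; this identifies the operations of the quotient. *)
Require Import Defs.
From mathcomp Require Import all_boot.
From mathcomp Require Import boolp classical_sets functions.

Set Implicit Arguments.
Unset Strict Implicit.
Unset Printing Implicit Defensive.

Local Open Scope classical_set_scope.

Section PowerAlgebra.
Variables (F : Type) (ar : F -> nat) (M : multiAlgebra ar).

(** Nonemptiness makes [meets] reflexive and lets the sets [members m] cover the whole algebra. *)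
Definition nonempty_set : Type := {S : set M | S !=set0}.

Definition singleton (m : M) : nonempty_set :=
  exist _ [set m] (ex_intro _ m erefl).

Lemma nonempty_set_inhabited : inhabited nonempty_set.
Proof. by case: (mcarrier_inhabited M) => m; exact: inhabits (singleton m). Qed.

Definition complex_op (f : F) (S : 'I_(ar f) -> nonempty_set) : set M :=
  \bigcup_(s in [set s | forall i, sval (S i) (s i)]) mop M f s.

Lemma complex_op_nonempty f (S : 'I_(ar f) -> nonempty_set) :
  complex_op S !=set0.
Proof.
have [s Ss] := choice (fun i => svalP (S i)).
by have [m fm] := mop_nonempty s; exists m, s.
Qed.

Definition power_algebra : algebra ar :=
  Algebra nonempty_set_inhabited
    (fun f S => exist _ (complex_op S) (complex_op_nonempty S)).

Definition meets (S T : power_algebra) : Prop :=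
  exists m, sval S m /\ sval T m.

Definition members (m : M) : set power_algebra := [set S | sval S m].

Lemma meets_tolerance : tolerance meets.
Proof.
split=> [S|S T [m [Sm Tm]]|f S T meetST].
- by have [m Sm] := svalP S; exists m.
- by exists m.
(* A single tuple [u] drawn from the intersections serves both sides: any value in [mop M f u] lies
   in both results. *)
- have [u STu] := choice meetST.
  have [m fm] := mop_nonempty u.
  by exists m; split; exists u => // i; case: (STu i).
Qed.

(** Tested on the singleton of [m]. This yields both the incomparability of the blocks and the
    injectivity of [members]. *)
Lemma members_sub m m' : members m `<=` members m' -> m = m'.
Proof. by move=> /(_ (singleton m) erefl). Qed.

Lemma members_block m : tolerance_block meets (members m).
Proof.
split=> [S T Sm Tm|C cliqueC mC]; first by exists m.
apply/seteqP; split=> // S CS.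
have [x [Sx /= xm]] := cliqueC _ _ CS (mC (singleton m) erefl).
by rewrite /members /= -xm.
Qed.

Lemma members_full_covering : full_covering meets (range members).
Proof.
split; first split.
- by move=> _ _ [m _ <-] [m' _ <-] /members_sub ->.
- apply/seteqP; split=> // S _; have [m Sm] := svalP S.
  by exists (members m) => //; exists m.
- by move=> _ [m _ <-]; exact: members_block.
- move=> S T; split=> [[m [Sm Tm]]|[_ [[m _ <-] Sm Tm]]].
    by exists (members m); split=> //; exists m.
  by exists m.
Qed.

Lemma members_isomorphism : isomorphism_to_quotient (range members) members.
Proof.
split=> [|f m].
  by split=> // m m' _ _ eq_mm'; apply: members_sub; rewrite eq_mm'.
apply/seteqP; split=> [_ [x fx <-]|_ [[x _ <-] fx]].
  by split=> [|S Sm]; [exists x | exists m].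
exists x => //.
(* Evaluate [fx] at the singletons of the [m i], from which [m] is the only tuple that can be
   drawn. *)
have [s sm fs] : complex_op (fun i => singleton (m i)) x by exact: fx.
by have <- : s = m by apply/funext => i; exact: sm.
Qed.

End PowerAlgebra.

Theorem theorem2p2 (F : Type) (ar : F -> nat) (M : multiAlgebra ar) :
  exists (A : algebra ar) (tau : A -> A -> Prop) (CC : set (set A)),
    [/\ tolerance tau,
        full_covering tau CC
      & exists phi : M -> set A, isomorphism_to_quotient CC phi].
Proof.
exists (power_algebra M), (@meets _ _ M), (range (@members _ _ M)).
split; [exact: meets_tolerance | exact: members_full_covering |].
by exists (@members _ _ M); exact: members_isomorphism.
Qed.
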